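(* There exist universal constants $c,c'>0$ such that the following holds. Let $n\in\mathbb{N}$, $\sigma^2>0$, $0<\tau_1\le\dots\le\tau_n$, $L,\Delta>0$ and $0<\varepsilon\le c'L\Delta$. Let $A=\{A_d\}_{d\in\mathbb{N}}$ be a family of zero-respecting algorithms for the time multiple oracles protocol ($A_d$ acting on $\mathbb{R}^d$). Then there exist $d\in\mathbb{N}$, a function $f\in\mathcal{F}_{\Delta,L}$ on $\mathbb{R}^d$, and an admissible choice of oracles and distributions $((O_1,\dots,O_n),(\mathcal{D}_1,\dots,\mathcal{D}_n))$ from the oracle class $\mathcal{O}^{\sigma^2}_{\tau_1,\dots,\tau_n}(f)$ such that, when $A_d$ is run in the time multiple oracles protocol with these oracles, $$\mathbb{E}\Big[\inf_{k\in S_t}\|\nabla f(x^k)\|^2\Big]>\varepsilon\quad\text{for}\quad t=c\cdot\min_{m\in[n]}\left[\Big(\frac1m\sum_{i=1}^m\frac1{\tau_i}\Big)^{-1}\Big(\frac{L\Delta}{\varepsilon}+\frac{\sigma^2L\Delta}{m\varepsilon^2}\Big)\right].$$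
   Context: Notation: $[n]=\{1,\dots,n\}$, $\mathbb{N}_0=\{0,1,2,\dots\}$; for $x\in\mathbb{R}^d$, $\mathrm{supp}(x)=\{i\in[d]: x_i\neq0\}$. Time multiple oracles protocol. There are $n$ oracles $O_1,\dots,O_n$ with distributions $\mathcal{D}_1,\dots,\mathcal{D}_n$ on a sample space $\mathbb{S}_\xi$. An algorithm is a sequence $A=\{A^k\}_{k\ge0}$ with $A^0\in\mathbb{R}_{\ge0}\times[n]\times\mathbb{R}^d$ and $A^k:(\mathbb{R}^d)^k\to\mathbb{R}_{\ge0}\times[n]\times\mathbb{R}^d$ for $k\ge1$, such that for all $k\ge1$ and all $g^1,\dots,g^k$ the first (time) component of $A^k(g^1,\dots,g^k)$ is at least the first component of $A^{k-1}(g^1,\dots,g^{k-1})$. Each oracle $i$ has a state in $\mathbb{R}_{\ge0}\times\mathbb{R}^d\times\{0,1\}$, initially $s_i^0=(0,0,0)$. Set $t^0=0$. For $k=0,1,2,\dots$: $(t^{k+1},i^{k+1},x^k)=A^k(g^1,\dots,g^k)$ ($=A^0$ for $k=0$); draw $\xi^{k+1}\sim\mathcal{D}_{i^{k+1}}$ independently of everything before; $(s^{k+1}_{i^{k+1}},g^{k+1})=O_{i^{k+1}}(t^{k+1},x^k,s^k_{i^{k+1}},\xi^{k+1})$, and $s^{k+1}_j=s^k_j$ for $j\ne i^{k+1}$. For $t\ge0$, $S_t=\{k\in\mathbb{N}_0: t^k\le t\}$. Delayed oracle. For $\tau>0$ and a mapping $G:\mathbb{R}^d\times\mathbb{S}_\xi\to\mathbb{R}^d$,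 the oracle $O^G_\tau(t,x,(s_t,s_x,s_q),\xi)$ returns $((t,x,1),0)$ if $s_q=0$; $((s_t,s_x,1),0)$ if $s_q=1$ and $t<s_t+\tau$; $((0,0,0),G(s_x;\xi))$ if $s_q=1$ and $t\ge s_t+\tau$. Zero-respecting: an algorithm is zero-respecting if $\mathrm{supp}(x^k)\subseteq\bigcup_{j=1}^k\mathrm{supp}(g^j)$ for all $k\in\mathbb{N}_0$ and all realizations (so $x^0=0$). Function class $\mathcal{F}_{\Delta,L}$: differentiable $f:\mathbb{R}^d\to\mathbb{R}$ with $\|\nabla f(x)-\nabla f(y)\|\le L\|x-y\|$ for all $x,y$ and $f(0)-\inf_x f(x)\le\Delta$. Oracle class $\mathcal{O}^{\sigma^2}_{\tau_1,\dots,\tau_n}(f)$: an admissible choice consists of a sample space $\mathbb{S}_\xi$, distributions $\mathcal{D}_1,\dots,\mathcal{D}_n$ on it, and a single mapping $G:\mathbb{R}^d\times\mathbb{S}_\xi\to\mathbb{R}^d$ such that for all $x$ and all $i$, $\mathbb{E}_{\xi\sim\mathcal{D}_i}[G(x;\xi)]=\nabla f(x)$ and $\mathbb{E}_{\xi\sim\mathcal{D}_i}\|G(x;\xi)-\nabla f(x)\|^2\le\sigma^2$; the oracles are $O_i=O^G_{\tau_i}$. *)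

(* Defs.v *)
From HB Require Import structures.
From mathcomp Require Import all_boot all_order all_algebra.
From mathcomp Require Import all_classical all_reals all_analysis.
From mathcomp Require Import Rstruct Rstruct_topology.
Set Implicit Arguments. Unset Strict Implicit. Unset Printing Implicit Defensive.
Import Order.TTheory GRing.Theory Num.Theory.
Import numFieldNormedType.Exports.
Local Open Scope classical_set_scope.
Local Open Scope ring_scope.

Notation R := Rdefinitions.R.

Definition enorm (d : nat) (v : 'rV[R]_d) : R := Num.sqrt (\sum_(j < d) v ord0 j ^+ 2).

Definition supp (d : nat) (v : 'rV[R]_d) : {set 'I_d} := [set j | v ord0 j != 0].

Definition grad (d : nat) (f : 'rV[R]_d -> R) (x : 'rV[R]_d) : 'rV[R]_d :=
  \row_(j < d) ('d (f : 'rV[R]_d -> R^o) x (delta_mx ord0 j : 'rV[R]_d)).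

Definition in_F (d : nat) (Delta L : R) (f : 'rV[R]_d -> R) : Prop :=
  (forall x, differentiable (f : 'rV[R]_d -> R^o) x) /\
  (forall x y, enorm (grad f x - grad f y) <= L * enorm (x - y)) /\
  ((f 0)%:E - ereal_inf (range (fun x => (f x)%:E)) <= Delta%:E)%E.

(* An algorithm on R^d with n oracles: A^k is A applied to a sequence of length k.
   The output is (time, oracle index, point). *)
Definition algo (n d : nat) := seq 'rV[R]_d -> R * 'I_n * 'rV[R]_d.

Definition algo_time n d (A : algo n d) g := (A g).1.1.
Definition algo_oracle n d (A : algo n d) g := (A g).1.2.
Definition algo_point n d (A : algo n d) g := (A g).2.

Definition valid_algo n d (A : algo n d) : Prop :=
  (forall g, 0 <= algo_time A g) /\
  (forall g v, algo_time A g <= algo_time A (rcons g v)).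

Definition zero_respecting n d (A : algo n d) : Prop :=
  forall g : seq 'rV[R]_d, supp (algo_point A g) \subset \bigcup_(v <- g) supp v.

Definition ostate (d : nat) := (R * 'rV[R]_d * bool)%type.

Definition delayed_oracle (d : nat) (S : Type) (G : 'rV[R]_d -> S -> 'rV[R]_d)
  (tau t : R) (x : 'rV[R]_d) (s : ostate d) (xi : S) : ostate d * 'rV[R]_d :=
  let: (st, sx, sq) := s in
  if ~~ sq then ((t, x, true), 0)
  else if t < st + tau then ((st, sx, true), 0)
  else ((0, 0, false), G sx xi).

(* The time multiple oracles protocol, given the realized samples:
   xi k i is the sample used if oracle i is called at step k (i.e. xi^{k+1}).
   run k = (g^1..g^k, oracle states after k steps). *)
Fixpoint run n d (S : Type) (A : algo n d) (G : 'rV[R]_d -> S -> 'rV[R]_d)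
  (tau : 'I_n -> R) (xi : nat -> 'I_n -> S) (k : nat) : seq 'rV[R]_d * ('I_n -> ostate d) :=
  match k with
  | 0 => ([::], fun _ => (0, 0, false))
  | k'.+1 =>
      let: (hist, st) := run A G tau xi k' in
      let: (t, i, x) := A hist in
      let: (s', g) := delayed_oracle G (tau i) t x (st i) (xi k' i) in
      (rcons hist g, fun j => if j == i then s' else st j)
  end.

(* x^k and t^k (t^0 = 0, (t^{k+1}, i^{k+1}, x^k) = A^k(g^1..g^k)). *)
Definition proto_x n d S A G tau xi (k : nat) : 'rV[R]_d :=
  algo_point A (@run n d S A G tau xi k).1.
Definition proto_t n d S A G tau xi (k : nat) : R :=
  if k is k'.+1 then algo_time A (@run n d S A G tau xi k').1 else 0.

Definition outcome n d S A G tau xi (f : 'rV[R]_d -> R) (t : R) : \bar R :=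
  ereal_inf [set ((enorm (grad f (@proto_x n d S A G tau xi k))) ^+ 2)%:E
            | k in [set k | @proto_t n d S A G tau xi k <= t]].

Definition admissible n d (dS : measure_display) (S : measurableType dS)
  (D : 'I_n -> probability S R) (G : 'rV[R]_d -> S -> 'rV[R]_d)
  (f : 'rV[R]_d -> R) (sigma2 : R) : Prop :=
  forall x i,
    (forall j, (D i).-integrable setT (fun xi => ((G x xi) ord0 j)%:E) /\
               (\int[D i]_xi ((G x xi) ord0 j)%:E = ((grad f x) ord0 j)%:E)%E) /\
    (\int[D i]_xi ((enorm (G x xi - grad f x)) ^+ 2)%:E <= sigma2%:E)%E.

(* Realization of the sampling: a family (xi k i)_{k,i} of mutually independent
   S-valued random elements with xi k i ~ D_i; at step k the protocol uses
   xi k i^{k+1}, which is then distributed as D_{i^{k+1}} independently of the past. *)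
Definition sampling n (dS : measure_display) (S : measurableType dS)
  (D : 'I_n -> probability S R) (dO : measure_display) (O : measurableType dO)
  (P : probability O R) (xi : nat -> 'I_n -> O -> S) : Prop :=
  (forall k i, measurable_fun setT (xi k i)) /\
  (forall k i B, measurable B -> P (xi k i @^-1` B) = D i B) /\
  (forall (s : seq (nat * 'I_n)) (B : nat -> 'I_n -> set S), uniq s ->
     (forall p, p \in s -> measurable (B p.1 p.2)) ->
     P (\big[setI/setT]_(p <- s) (xi p.1 p.2 @^-1` B p.1 p.2)) =
     (\prod_(p <- s) P (xi p.1 p.2 @^-1` B p.1 p.2))%E).

Definition tbound_term n (tau : 'I_n -> R) (sigma2 L Delta eps : R) (m : nat) : R :=
  ((m%:R)^-1 * \sum_(i < n | (i < m)%N) (tau i)^-1)^-1 *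
  (L * Delta / eps + sigma2 * L * Delta / (m%:R * eps ^+ 2)).

Definition tbound n (tau : 'I_n -> R) (sigma2 L Delta eps : R) : R :=
  \big[Num.min/tbound_term tau sigma2 L Delta eps 1]_(m < n)
     tbound_term tau sigma2 L Delta eps m.+1.

(* Main.v *)
Require Import Defs.
From HB Require Import structures.
From mathcomp Require Import all_boot all_order all_algebra.
From mathcomp Require Import all_classical all_reals all_analysis.
From mathcomp Require Import Rstruct Rstruct_topology.
From mathcomp Require Import measurable_realfun.
From mathcomp Require Import ring lra zify.
Set Implicit Arguments. Unset Strict Implicit. Unset Printing Implicit Defensive.
Import Order.TTheory GRing.Theory Num.Theory.
Import numFieldNormedType.Exports.
Local Open Scope classical_set_scope.
Local Open Scope ring_scope.

(* The hard function is a chain of [d] coordinates, of order L Delta / eps: its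
   gradient is large as long as the last coordinate vanishes, and at a point whose
   last nonzero coordinate is the [m]-th, a gradient reveals only coordinate [m+1].
   The oracle rescales the entries beyond coordinate [m] by a Bernoulli variable
   divided by its mean [p], of order min(1, eps / sigma2), so each reported gradient
   extends the progress only with probability [p], and only if its computation
   started after the previous extension.

   Call a level of progress fast if it ends within its first N - 1 gradients, N of
   order 1/p. A level that is not fast lasts at least the time [ts] the oracles need
   for N gradients from scratch. At most (N - 1)(d + 1) gradients can make a level
   fast, each with conditional probability [p], so by Markov's inequality fewer than
   half of the levels are fast with probability at least 1/2, and then the run takes
   time [ts d / 2] to reach coordinate [d]. If delta is the time for N gradients and m
   the number of oracles up to the last one used, then delta times the sum of the m
   rates 1/tau_i is at least max(N, m), which turns [ts] into the stated minimum. *)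

(** * The chain function *)
Section chain_function.
Context {K : realType}.
Implicit Types u v : K.

(** [sstep] is the cubic smoothstep, flat outside [0, 1]. [wstep] is that step stretched to [-2, 2],
    so that its slope is positive at 0, where an undiscovered coordinate sits. [barrier] penalizes
    negative coordinates. *)
Definition clamp (u : K) : K := if u <= 0 then 0 else if u <= 1 then u else 1.
Definition sstep (u : K) : K := 3 * clamp u ^+ 2 - 2 * clamp u ^+ 3.
Definition dsstep (u : K) : K := 6 * clamp u * (1 - clamp u).
Definition wstep (u : K) : K := sstep ((u + 2) / 4).
Definition dwstep (u : K) : K := dsstep ((u + 2) / 4) / 4.
Definition barrier (u : K) : K := if u <= 0 then u ^+ 2 / 2 else 0.
Definition dbarrier (u : K) : K := if u <= 0 then u else 0.

Lemma clamp_bound u : 0 <= clamp u <= 1.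
Proof. by rewrite /clamp; case: (leP u 0) => ?; [|case: (leP u 1) => ?]; lra. Qed.

Lemma clamp_lip u v : `|clamp u - clamp v| <= `|u - v|.
Proof.
rewrite /clamp ler_norml; have := ler_norm (u - v); have := ler_norm (v - u).
rewrite (distrC v u); set n := `|u - v|.
by case: (leP u 0) => ?; case: (leP v 0) => ?; try case: (leP u 1) => ?;
  try case: (leP v 1) => ?; try lra.
Qed.

Lemma sstep_ge0 u : 0 <= sstep u.
Proof.
have /andP[? ?] := clamp_bound u.
have -> : sstep u = clamp u ^+ 2 * (3 - 2 * clamp u) by rewrite /sstep; ring.
by rewrite mulr_ge0 ?sqr_ge0//; lra.
Qed.

Lemma sstep_le1 u : sstep u <= 1.
Proof.
have /andP[? ?] := clamp_bound u.
have <- : 1 - (1 - clamp u) ^+ 2 * (1 + 2 * clamp u) = sstep u by rewrite /sstep; ring.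
by rewrite gerBl mulr_ge0 ?sqr_ge0//; lra.
Qed.

Lemma dsstep_ge0 u : 0 <= dsstep u.
Proof. by have /andP[? ?] := clamp_bound u; rewrite /dsstep !mulr_ge0//; lra. Qed.

Lemma dsstep_le u : dsstep u <= 3 / 2.
Proof.
have <- : 3 / 2 - 6 * (clamp u - 1 / 2) ^+ 2 = dsstep u by rewrite /dsstep; field.
by rewrite gerBl mulr_ge0 ?sqr_ge0.
Qed.

Lemma sstep0 : sstep 0 = 0.
Proof. by rewrite /sstep /clamp lexx; lra. Qed.
Lemma dsstep0 : dsstep 0 = 0.
Proof. by rewrite /dsstep /clamp lexx; lra. Qed.
Lemma sstep_ge1 u : 1 <= u -> sstep u = 1.
Proof. by move=> u1; rewrite /sstep /clamp; case: (leP u 0) => ?; [|case: (leP u 1) => ?]; nra. Qed.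

Lemma sstep_lip u v : `|sstep u - sstep v| <= 3 / 2 * `|u - v|.
Proof.
apply: le_trans (_ : 3 / 2 * `|clamp u - clamp v| <= _); last first.
  by rewrite ler_wpM2l ?clamp_lip//; lra.
have -> : sstep u - sstep v = (clamp u - clamp v) *
   (3 * (clamp u + clamp v) - 2 * (clamp u ^+ 2 + clamp u * clamp v + clamp v ^+ 2)).
  by rewrite /sstep; ring.
rewrite normrM mulrC ler_wpM2r// ler_norml.
have := clamp_bound u; have := clamp_bound v; move: (clamp u) (clamp v) => a b.
move=> /andP[b0 b1] /andP[a0 a1]; apply/andP; split.
  have -> : 3 * (a + b) - 2 * (a ^+ 2 + a * b + b ^+ 2) =
    2 * (a * (1 - a)) + 2 * (b * (1 - b)) + a * (1 - b) + b * (1 - a) by ring.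
  apply: (@le_trans _ _ 0); first by lra.
  by rewrite !addr_ge0 ?mulr_ge0//; lra.
have -> : 3 * (a + b) - 2 * (a ^+ 2 + a * b + b ^+ 2) =
  3 / 2 - (3 / 2 * (a + b - 1) ^+ 2 + 1 / 2 * (a - b) ^+ 2) by field.
by rewrite gerBl addr_ge0// mulr_ge0 ?sqr_ge0//; lra.
Qed.

Lemma dsstep_lip u v : `|dsstep u - dsstep v| <= 6 * `|u - v|.
Proof.
apply: le_trans (_ : 6 * `|clamp u - clamp v| <= _); last first.
  by rewrite ler_wpM2l ?clamp_lip//; lra.
have -> : dsstep u - dsstep v = (clamp u - clamp v) * (6 * (1 - clamp u - clamp v)).
  by rewrite /dsstep; ring.
rewrite normrM mulrC ler_wpM2r// ler_norml.
have /andP[? ?] := clamp_bound u; have /andP[? ?] := clamp_bound v; lra.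
Qed.

(** A quadratic remainder bound also settles differentiability at the points where a piecewise
    definition changes. *)
Lemma quad_is_derive (f : K -> K) (x a C : K) :
  (forall h, `|f (x + h) - f x - a * h| <= C * h ^+ 2) ->
  is_derive x 1 f a.
Proof.
move=> H.
have C0 : 0 <= C.
  have := H 1; rewrite expr1n !mulr1 => H1; exact: le_trans (normr_ge0 _) H1.
have L : h^-1 *: (f (h *: 1%R + x) - f x) @[h --> 0^'] --> a.
  have C1 : 0 < C + 1 by rewrite ltr_wpDl.
apply/cvgrPdist_le => e e0; near=> h.
  have he : `|h| < e / (C + 1) by near: h; apply: dnbhs0_lt; rewrite divr_gt0.
  have h0 : h != 0 by near: h; exact: nbhs_dnbhs_neq.
  have -> : a - h^-1 *: (f (h *: (1 : K^o) + (x : K^o)) - f x) =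
            - (h^-1 * (f (x + h) - f x - a * h)).
    rewrite /GRing.scale/= mulr1 (addrC h) (mulrBr _ _ (a * h)) mulrCA mulVf// mulr1; lra.
  rewrite normrN normrM normfV ler_pdivrMl ?normr_gt0//.
  apply: le_trans (H h) _; rewrite -real_normK ?num_real// expr2 (mulrC C) -mulrA ler_wpM2l//.
  have : `|h| * (C + 1) < e by rewrite -ltr_pdivlMr.
  have := normr_ge0 h; lra.
apply: DeriveDef; first exact: cvgP L.
exact: cvg_lim L.
Unshelve. all: by end_near.
Qed.

(** [clamp] has kinks at 0 and 1, but the factor [clamp x * (1 - clamp x)] vanishes there. If [x] is
    inside and [x + h] leaves [0, 1], both this factor and the error of the linear approximation are
    at most [|h|]. *)
Lemma clamp_increment (x h : K) :
  `|clamp x * (1 - clamp x) * (clamp (x + h) - clamp x - h)| <= h ^+ 2.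
Proof.
have h2 := sqr_ge0 h; have := clamp_bound (x + h).
rewrite {2}/clamp /clamp; case: (leP x 0) => x0; first by rewrite !mul0r normr0.
case: (leP x 1) => x1; last by rewrite subrr mulr0 mul0r normr0.
case: (leP (x + h) 0) => xh0; last case: (leP (x + h) 1) => xh1.
- have A0 : 0 <= x * (1 - x) by rewrite mulr_ge0//; lra.
  have Ah : x * (1 - x) <= - h by nra.
  move: (x * (1 - x)) A0 Ah => A A0 Ah _.
  rewrite ler_norml -(sqrrN h); apply/andP; split.
    by rewrite (le_trans (_ : _ <= 0)) ?mulr_ge0 ?oppr_le0 ?sqr_ge0//; lra.
  by rewrite expr2 ler_pM//; lra.
- by rewrite (_ : x + h - x - h = 0) ?mulr0 ?normr0//; ring.
have A0 : 0 <= x * (1 - x) by rewrite mulr_ge0//; lra.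
have Ah : x * (1 - x) <= h by nra.
move: (x * (1 - x)) A0 Ah => A A0 Ah _.
rewrite -normrN -mulrN ler_norml; apply/andP; split.
  by rewrite (le_trans (_ : _ <= 0)) ?mulr_ge0 ?oppr_le0 ?sqr_ge0//; lra.
by rewrite expr2 ler_pM//; lra.
Qed.

Lemma sstep_is_derive (x : K) : is_derive x 1 sstep (dsstep x).
Proof.
(* 9 = 3 + 6: a term quadratic in the increment of [clamp], with factor at most 3, and 6 times the
   quantity of [clamp_increment]. *)
apply: (@quad_is_derive _ _ _ 9) => h.
have -> : sstep (x + h) - sstep x - dsstep x * h =
  (clamp (x + h) - clamp x) ^+ 2 * (3 - 2 * clamp (x + h) - 4 * clamp x) +
  6 * (clamp x * (1 - clamp x) * (clamp (x + h) - clamp x - h)).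
  by rewrite /sstep /dsstep; ring.
apply: le_trans (ler_normD _ _) _; rewrite [leRHS](_ : _ = h ^+ 2 * 3 + 6 * h ^+ 2); last by ring.
apply: lerD; last by rewrite normrM ger0_norm// ler_wpM2l// clamp_increment.
rewrite normrM ler_pM//; last first.
  have /andP[? ?] := clamp_bound x; have /andP[? ?] := clamp_bound (x + h).
  by rewrite ler_norml; lra.
rewrite ger0_norm ?sqr_ge0// -ler_sqrt ?sqr_ge0// !sqrtr_sqr.
by rewrite (le_trans (clamp_lip _ _))// (_ : x + h - x = h)//; ring.
Qed.

Lemma wstep_is_derive (x : K) : is_derive x 1 wstep (dwstep x).
Proof.
pose l (y : K) := 4^-1 * (y + 2).
have dl : is_derive x 1 l 4^-1.
  by rewrite /l; apply: is_derive_eq; rewrite addr0 /GRing.scale/= mulr1.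
have ds := sstep_is_derive (l x).
have -> : wstep = sstep \o l by apply/funext => y; rewrite /wstep /l /= mulrC.
have H := @is_derive1_comp _ sstep l x _ _ ds dl.
have E : dsstep (l x) * 4^-1 = dwstep x by rewrite /dwstep /l (mulrC 4^-1 (x + 2)).
by rewrite -E.
Qed.

Lemma barrier_is_derive (x : K) : is_derive x 1 barrier (dbarrier x).
Proof.
apply: (@quad_is_derive _ _ _ 1) => h; rewrite ler_norml /barrier /dbarrier.
by case: (leP x 0) => ?; case: (leP (x + h) 0) => ?; apply/andP; split; nra.
Qed.


Lemma barrier_ge0 u : 0 <= barrier u.
Proof. by rewrite /barrier; case: ifP => // _; rewrite divr_ge0 ?sqr_ge0. Qed.

Lemma barrier0 : barrier 0 = 0 :> K.
Proof. by rewrite /barrier lexx expr0n mul0r. Qed.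

Lemma dbarrier0 : dbarrier 0 = 0 :> K.
Proof. by rewrite /dbarrier lexx. Qed.

Lemma dbarrier_le0 u : dbarrier u <= 0.
Proof. by rewrite /dbarrier; case: ifP. Qed.

Lemma dbarrier_lip u v : `|dbarrier u - dbarrier v| <= `|u - v|.
Proof.
rewrite /dbarrier ler_norml; have := ler_norm (u - v); have := ler_norm (v - u).
rewrite (distrC v u); set n := `|u - v|.
by case: (leP u 0) => ?; case: (leP v 0) => ?; try lra.
Qed.

Lemma wstep_ge0 u : 0 <= wstep u. Proof. exact: sstep_ge0. Qed.
Lemma wstep_le1 u : wstep u <= 1. Proof. exact: sstep_le1. Qed.

Lemma dwstep_ge0 u : 0 <= dwstep u.
Proof. by rewrite divr_ge0 ?dsstep_ge0. Qed.

Lemma dwstep_le u : dwstep u <= 3 / 8.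
Proof. by have := dsstep_le ((u + 2) / 4); rewrite /dwstep; lra. Qed.

Lemma dwstep_ge u : -1 <= u <= 1 -> 1 / 4 <= dwstep u.
Proof.
move=> /andP[u1 u2]; rewrite /dwstep /dsstep /clamp.
case: (leP ((u + 2) / 4) 0) => ?; first by lra.
case: (leP ((u + 2) / 4) 1) => ?; last by lra.
nra.
Qed.

Lemma wstep_lip u v : `|wstep u - wstep v| <= 3 / 8 * `|u - v|.
Proof.
apply: le_trans (sstep_lip _ _) _.
rewrite (_ : (u + 2) / 4 - (v + 2) / 4 = (u - v) / 4); last by field.
by rewrite normrM (ger0_norm (_ : 0 <= 4^-1)) ?invr_ge0//; lra.
Qed.

Lemma dwstep_lip u v : `|dwstep u - dwstep v| <= 3 / 8 * `|u - v|.
Proof.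
rewrite /dwstep -mulrBl normrM (ger0_norm (_ : 0 <= 4^-1)) ?invr_ge0//.
have := dsstep_lip ((u + 2) / 4) ((v + 2) / 4).
rewrite (_ : (u + 2) / 4 - (v + 2) / 4 = (u - v) / 4); last by field.
by rewrite [`|_ / 4|]normrM (ger0_norm (_ : 0 <= 4^-1)) ?invr_ge0//; lra.
Qed.

Lemma is_diff_is_derive (phi : K -> K) (a x : K) :
  is_derive x 1 phi a -> is_diff x phi (fun h => a * h).
Proof.
move=> [dphi phiE]; apply: DiffDef; first exact/derivable1_diffP.
by rewrite deriv1E// derive1E phiE; apply/funext => v; rewrite /GRing.scale/= mulrC.
Qed.

Lemma is_diff_comp_derive (V : normedModType K) (g : V -> K) (dg : V -> K) (x : V)
    (phi : K -> K) (a : K) :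
  is_diff x g dg -> is_derive (g x) 1 phi a ->
  is_diff x (fun y => phi (g y)) (fun h => a * dg h).
Proof.
move=> gx phix; have phix' := is_diff_is_derive phix.
exact: (@is_diff_comp _ _ _ _ g dg phi (fun h => a * h) x).
Qed.

Lemma is_diff_sum (V : normedModType K) n (f df : 'I_n -> V -> K) (x : V) :
  (forall i, is_diff x (f i) (df i)) ->
  is_diff x (fun y => \sum_(i < n) f i y) (fun h => \sum_(i < n) df i h).
Proof.
elim: n f df => [|n IH] f df H.
  have -> : (fun y => \sum_(i < 0) f i y) = cst 0 by apply/funext => y; rewrite big_ord0.
  apply: is_diff_eq; by apply/funext => v; rewrite big_ord0.
have -> : (fun y => \sum_(i < n.+1) f i y) =
    (fun y => \sum_(i < n) f (widen_ord (leqnSn n) i) y) + f ord_max.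
  by apply/funext => y; rewrite big_ord_recr.
have IH' := IH _ (fun i => df (widen_ord (leqnSn n) i)) (fun i => H _).
apply: is_diff_eq; by apply/funext => v; rewrite big_ord_recr.
Qed.

(* Coordinates are indexed by [nat] and extended by [0], so that the chain has
   no boundary case at its end; [prevcoord] shifts the index and puts [1] in front. *)
Definition ncoord d (x : 'rV[K]_d) (k : nat) : K := oapp (x ord0) 0 (insub k).
Definition prevcoord d (x : 'rV[K]_d) (k : nat) : K := if k is k'.+1 then ncoord x k' else 1.

Lemma ncoord_ord d (x : 'rV[K]_d) (j : 'I_d) : ncoord x j = x ord0 j.
Proof. by rewrite /ncoord valK. Qed.

Lemma ncoord_out d (x : 'rV[K]_d) k : (d <= k)%N -> ncoord x k = 0.
Proof. by move=> dk; rewrite /ncoord insubF// ltnNge dk. Qed.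

Lemma ncoord_delta d (j : 'I_d) k : ncoord (delta_mx ord0 j) k = (k == j)%:R.
Proof.
rewrite /ncoord; case: insubP => /= [i _ <-|]; first by rewrite mxE eqxx.
by rewrite -leqNgt => dk; case: eqP => // kj; move: (ltn_ord j); rewrite -kj ltnNge dk.
Qed.

Lemma is_diff_ncoord d (x : 'rV[K]_d) k : is_diff x (fun y => ncoord y k) (fun h => ncoord h k).
Proof.
rewrite /ncoord; case: insubP => /= [i _ _|_]; last exact: is_diff_cst.
apply: DiffDef; first exact: differentiable_coord.
pose f (y : 'rV[K]_d) : K := y ord0 i.
have lf : linear f by move=> a y z; rewrite /f !mxE.
pose fM := GRing.isLinear.Build _ _ _ _ _ lf.
pose fL : {linear _ -> _} := HB.pack f fM.
by rewrite -[LHS]/('d (fL : _ -> _) x : _ -> _) diff_lin//; exact: coord_continuous.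
Qed.

Definition dprevcoord d (x : 'rV[K]_d) (k : nat) : K := if k is k'.+1 then ncoord x k' else 0.

Lemma is_diff_prevcoord d (x : 'rV[K]_d) k :
  is_diff x (fun y => prevcoord y k) (fun h => dprevcoord h k).
Proof. by case: k => [|k] /=; [exact: is_diff_cst|exact: is_diff_ncoord]. Qed.

(** The factor [sstep] of the previous coordinate switches on the slope in the next one. In the last
    of the [d.+1] products the current coordinate is the constant 0, which keeps the partial
    derivatives uniform in the index. *)
Definition chain d (x : 'rV[K]_d) : K :=
  \sum_(k < d) barrier (ncoord x k) - \sum_(k < d.+1) sstep (prevcoord x k) * wstep (ncoord x k).

Definition dchain d (x : 'rV[K]_d) : 'rV[K]_d :=
  \row_j (dbarrier (ncoord x j) - dsstep (ncoord x j) * wstep (ncoord x j.+1)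
          - sstep (prevcoord x j) * dwstep (ncoord x j)).

Lemma is_diff_chain d (x : 'rV[K]_d) :
  is_diff x (@chain d) (fun h => \sum_(k < d) dbarrier (ncoord x k) * ncoord h k
    - \sum_(k < d.+1) (sstep (prevcoord x k) * (dwstep (ncoord x k) * ncoord h k) +
                       wstep (ncoord x k) * (dsstep (prevcoord x k) * dprevcoord h k))).
Proof.
apply: is_diffB.
  apply: is_diff_sum => k; apply: is_diff_comp_derive; first exact: is_diff_ncoord.
  exact: barrier_is_derive.
apply: is_diff_sum => k; apply: is_diffM.
  apply: is_diff_comp_derive; first exact: is_diff_prevcoord.
  exact: sstep_is_derive.
apply: is_diff_comp_derive; first exact: is_diff_ncoord.
exact: wstep_is_derive.
Qed.

Lemma chain_diff_delta d (x : 'rV[K]_d) (j : 'I_d) :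
  'd (@chain d) x (delta_mx ord0 j) = dchain x ord0 j.
Proof.
have H := is_diff_chain x; rewrite diff_val mxE /=.
rewrite (bigD1 j)//= big1 => [|k kj]; last first.
  by rewrite ncoord_delta (_ : _ == _ = false) ?mulr0//; apply/negbTE.
rewrite ncoord_delta eqxx mulr1 addr0 big_split/= -!addrA; congr (_ + _).
rewrite opprD addrC; congr (- _ + - _).
  rewrite (bigD1 (widen_ord (leqnSn d) j))//= big1 => [|k kj]; last first.
    by rewrite ncoord_delta (_ : _ == _ = false) ?mulr0//; apply/negbTE.
  by rewrite ncoord_delta eqxx mulr1 addr0.
rewrite big_ord_recl/= !mulr0 add0r (bigD1 j)//= big1 => [|k kj]; last first.
  by rewrite ncoord_delta (_ : _ == _ = false) ?mulr0//; apply/negbTE.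
by rewrite ncoord_delta eqxx mulr1 addr0 mulrC.
Qed.

Lemma chain_ge d (x : 'rV[K]_d) : - d.+1%:R <= chain x.
Proof.
have A : 0 <= \sum_(k < d) barrier (ncoord x k) by apply: sumr_ge0 => k _; exact: barrier_ge0.
have B : \sum_(k < d.+1) sstep (prevcoord x k) * wstep (ncoord x k) <= d.+1%:R.
  rewrite -[leRHS](_ : \sum_(k < d.+1) 1 = _); last by rewrite sumr_const card_ord.
  apply: ler_sum => k _; rewrite mulr_ile1 ?sstep_ge0 ?wstep_ge0 ?sstep_le1 ?wstep_le1//.
by rewrite /chain; lra.
Qed.

Lemma ncoord0 d k : ncoord (0 : 'rV[K]_d) k = 0.
Proof. by rewrite /ncoord; case: insubP => //= i _ _; rewrite mxE. Qed.

Lemma chain0_le0 d : chain (0 : 'rV[K]_d) <= 0.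
Proof.
rewrite /chain big1 => [|k _]; last by rewrite ncoord0 barrier0.
by rewrite sub0r oppr_le0 sumr_ge0// => k _; rewrite mulr_ge0 ?sstep_ge0 ?wstep_ge0.
Qed.

Lemma lip_mul (a b a' b' e e' M N : K) : `|a - b| <= e -> `|a' - b'| <= e' ->
  0 <= b <= M -> 0 <= a' <= N -> `|a * a' - b * b'| <= N * e + M * e'.
Proof.
move=> h1 h2 /andP[b0 bM] /andP[a0 aN].
rewrite (_ : a * a' - b * b' = a' * (a - b) + b * (a' - b')); last by ring.
apply: le_trans (ler_normD _ _) _; rewrite !normrM (ger0_norm a0) (ger0_norm b0).
by apply: lerD; apply: ler_pM => //; exact: normr_ge0.
Qed.

(** The coefficients are 9/16 for the previous coordinate, 1 + 6 + 3/8 for the current one and 9/16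
    for the next, all below 8. *)
Lemma dchain_lip_coord d (x y : 'rV[K]_d) (j : 'I_d) :
  `|dchain x ord0 j - dchain y ord0 j| <=
    8 * (`|prevcoord x j - prevcoord y j| + `|ncoord x j - ncoord y j| +
         `|ncoord x j.+1 - ncoord y j.+1|).
Proof.
rewrite !mxE.
have A := dbarrier_lip (ncoord x j) (ncoord y j).
have S0 u : 0 <= sstep u <= 1 by rewrite sstep_ge0 sstep_le1.
have W0 u : 0 <= wstep u <= 1 by rewrite wstep_ge0 wstep_le1.
have dS0 u : 0 <= dsstep u <= 3 / 2 by rewrite dsstep_ge0 dsstep_le.
have dW0 u : 0 <= dwstep u <= 3 / 8 by rewrite dwstep_ge0 dwstep_le.
have B := lip_mul (dsstep_lip (ncoord x j) (ncoord y j))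
  (wstep_lip (ncoord x j.+1) (ncoord y j.+1)) (dS0 _) (W0 _).
have C := lip_mul (sstep_lip (prevcoord x j) (prevcoord y j))
  (dwstep_lip (ncoord x j) (ncoord y j)) (S0 _) (dW0 _).
set D := _ - _; rewrite (_ : D = (dbarrier (ncoord x j) - dbarrier (ncoord y j)) -
  (dsstep (ncoord x j) * wstep (ncoord x j.+1) - dsstep (ncoord y j) * wstep (ncoord y j.+1)) -
  (sstep (prevcoord x j) * dwstep (ncoord x j) -
   sstep (prevcoord y j) * dwstep (ncoord y j))); last first.
  by rewrite /D; ring.
apply: le_trans (ler_normB _ _) _; apply: le_trans (lerD (ler_normB _ _) C) _.
apply: le_trans (lerD (lerD A B) (lexx _)) _.
have := normr_ge0 (prevcoord x j - prevcoord y j); have := normr_ge0 (ncoord x j - ncoord y j).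
have := normr_ge0 (ncoord x j.+1 - ncoord y j.+1); lra.
Qed.

(** The square of a sum of three terms is at most three times the sum of squares, whence 192 = 64 *
    3; three shifted copies of the sum then give 576. Shifting costs nothing, since the entries
    entering at either end have difference 0. *)
Lemma dchain_lip d (x y : 'rV[K]_d) :
  \sum_(j < d) (dchain x ord0 j - dchain y ord0 j) ^+ 2 <=
  24 ^+ 2 * \sum_(j < d) (x ord0 j - y ord0 j) ^+ 2.
Proof.
pose u k := (ncoord x k - ncoord y k) ^+ 2.
have u0 k : 0 <= u k by exact: sqr_ge0.
have -> : \sum_(j < d) (x ord0 j - y ord0 j) ^+ 2 = \sum_(j < d) u j.
  by apply: eq_bigr => j _; rewrite /u !ncoord_ord.
have uS : \sum_(j < d) u j.+1 <= \sum_(j < d) u j.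
  have E : \sum_(k < d.+1) u k = \sum_(k < d.+1) u k by [].
  have ud : u d = 0 by rewrite /u !ncoord_out// subrr expr0n.
  move: E; rewrite {1}big_ord_recr big_ord_recl/= ud addr0 => ->.
  by rewrite lerDr.
have uP : \sum_(j < d) (prevcoord x j - prevcoord y j) ^+ 2 <= \sum_(j < d) u j.
  case: d x y @u u0 uS => [|d] x y u u0 _; first by rewrite !big_ord0.
  by rewrite big_ord_recl/= subrr expr0n add0r big_ord_recr/= lerDl.
apply: le_trans (_ : \sum_(j < d) 192 * ((prevcoord x j - prevcoord y j) ^+ 2 + u j + u j.+1) <= _).
  apply: ler_sum => j _; rewrite -[leLHS]real_normK ?num_real// /u.
  rewrite -[(prevcoord x j - _) ^+ 2]real_normK ?num_real//.
  rewrite -[(ncoord x j - _) ^+ 2]real_normK ?num_real//.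
  rewrite -[(ncoord x j.+1 - _) ^+ 2]real_normK ?num_real//.
  have H := dchain_lip_coord x y j; have a0 := normr_ge0 (dchain x ord0 j - dchain y ord0 j).
  move: (`|dchain _ _ _ - _|) (`|prevcoord _ _ - _|) (`|ncoord x j - _|) (`|ncoord _ j.+1 - _|)
    a0 H.
  move=> a p q r a0 H.
  apply: le_trans (_ : (8 * (p + q + r)) ^+ 2 <= _).
    by rewrite lerXn2r ?nnegrE// (le_trans a0 H).
  rewrite -subr_ge0 (_ : _ - _ = 64 * ((p - q) ^+ 2 + (q - r) ^+ 2 + (p - r) ^+ 2)); last by ring.
  by rewrite mulr_ge0 ?addr_ge0 ?sqr_ge0.
rewrite -mulr_sumr !big_split (_ : 24 ^+ 2 = 192 * 3 :> K); last by ring.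
rewrite -mulrA ler_wpM2l// (_ : 3 * _ =
  \sum_(j < d) u j + \sum_(j < d) u j + \sum_(j < d) u j); last by ring.
by apply: lerD; first exact: lerD.
Qed.

(** [dbarrier], [dsstep] and [sstep] all vanish at 0; this is what lets a gradient discover only one
    new coordinate. *)
Lemma dchain_zero d (x : 'rV[K]_d) (j : 'I_d) :
  prevcoord x j = 0 -> ncoord x j = 0 -> dchain x ord0 j = 0.
Proof. by move=> p0 c0; rewrite mxE p0 c0 dbarrier0 dsstep0 sstep0 !mul0r !subr0. Qed.

(** Applied to the one new coordinate that a gradient reveals, the only noisy entry, this bounds the
    variance of the oracle. *)
Lemma dchain_frontier d (x : 'rV[K]_d) (j : 'I_d) :
  ncoord x j = 0 -> dchain x ord0 j ^+ 2 <= (3 / 8) ^+ 2.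
Proof.
move=> c0; rewrite mxE c0 dbarrier0 dsstep0 mul0r subr0 sub0r sqrrN.
have S0 := sstep_ge0 (prevcoord x j); have S1 := sstep_le1 (prevcoord x j).
have W0 := dwstep_ge0 (0 : K); have W1 := dwstep_le (0 : K).
apply: lerXn2r; rewrite ?nnegrE; [exact: mulr_ge0|lra|].
by rewrite -[leRHS]mul1r; apply: ler_pM.
Qed.

(* All the terms of a partial derivative have the same sign, so it suffices to
   find a coordinate at which one of them is large: the first one below [1]. If it
   is also below [-1], where [wstep] may be flat, the barrier term is the large one. *)
Lemma dchain_large d (x : 'rV[K]_d) : (0 < d)%N -> ncoord x d.-1 = 0 ->
  exists j : 'I_d, dchain x ord0 j <= - (1 / 4).
Proof.
move=> d0 xd.
have ex : exists k, (k < d)%N && (ncoord x k < 1).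
  by exists d.-1; rewrite xd ltr01 andbT prednK.
have [/= k /andP[kd xk] kmin] := ex_minnP ex.
have pk : 1 <= prevcoord x k.
  case: k kd {xk} kmin => //= k kd kmin; rewrite leNgt; apply/negP => xk.
  by have := kmin k; rewrite xk (ltnW kd) => /(_ isT); rewrite ltnn.
exists (Ordinal kd); rewrite mxE /= sstep_ge1// mul1r.
have h1 := dbarrier_le0 (ncoord x k).
have h2 : 0 <= dsstep (ncoord x k) * wstep (ncoord x k.+1).
  by rewrite mulr_ge0 ?dsstep_ge0 ?wstep_ge0.
have h3 := dwstep_ge0 (ncoord x k).
have [xk1|xk1] := leP (-1) (ncoord x k).
  by have := @dwstep_ge (ncoord x k); rewrite xk1 ltW// => /(_ isT); lra.
have : dbarrier (ncoord x k) <= -1 by rewrite /dbarrier; case: ifP => ?; lra.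
lra.
Qed.

(** Two free scales: [al] multiplies the gap, [al / la] the gradient, and [al / la ^+ 2] its
    Lipschitz constant. *)
Definition schain (al la : K) d (x : 'rV[K]_d) : K := al * chain (la^-1 *: x).

Lemma schain_differentiable al la d (x : 'rV[K]_d) : differentiable (schain al la (d := d)) x.
Proof.
have H := is_diff_chain (la^-1 *: x).
have -> : schain al la (d := d) = al \*: (@chain d \o ( *:%R la^-1)) by [].
apply: differentiableZ; apply: differentiable_comp; last exact: ex_diff.
exact: ex_diff.
Qed.

Lemma schain_diff_delta al la d (x : 'rV[K]_d) (j : 'I_d) :
  'd (schain al la (d := d)) x (delta_mx ord0 j) = al / la * dchain (la^-1 *: x) ord0 j.
Proof.
have I := is_diff_chain (la^-1 *: x).
have H : differentiable (@chain d) (la^-1 *: x) by exact: ex_diff.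
have H2 : differentiable ( *:%R la^-1 : 'rV[K]_d -> 'rV[K]_d) x by exact: ex_diff.
have -> : schain al la (d := d) = al \*: (@chain d \o ( *:%R la^-1)) by [].
rewrite diffZ; last by apply: differentiable_comp.
have E : 'd ( *:%R la^-1 : 'rV[K]_d -> 'rV[K]_d) x = ( *:%R la^-1) :> (_ -> _) by exact: diff_val.
rewrite /= diff_comp//= E linearZ /=.
by rewrite chain_diff_delta /GRing.scale/= mulrA.
Qed.
End chain_function.

(** * The hard instance: progress and stochastic oracle *)
Lemma enorm_sqr d (v : 'rV[R]_d) : enorm v ^+ 2 = \sum_(j < d) v ord0 j ^+ 2.
Proof. by rewrite sqr_sqrtr// sumr_ge0// => j _; exact: sqr_ge0. Qed.

Lemma enorm_le_sqr d (v w : 'rV[R]_d) (c : R) : 0 <= c ->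
  enorm v ^+ 2 <= c ^+ 2 * enorm w ^+ 2 -> enorm v <= c * enorm w.
Proof.
by move=> c0; rewrite -exprMn ler_sqr// nnegrE ?mulr_ge0// sqrtr_ge0.
Qed.

Lemma grad_schain (al la : R) d (x : 'rV[R]_d) :
  grad (schain al la (d := d)) x = (al / la) *: dchain (la^-1 *: x).
Proof. by apply/rowP => j; rewrite !mxE -[RHS]/(_ * _) schain_diff_delta !mxE. Qed.

Lemma schain_in_F d (al la Delta L : R) : 0 < al -> 0 < la ->
  24 * (al / la ^+ 2) <= L -> al * d.+1%:R <= Delta ->
  in_F Delta L (schain al la (d := d)).
Proof.
move=> al0 la0 aL aD; split; first by move=> x; exact: schain_differentiable.
have al_ge0 := ltW al0; have la_ge0 := ltW la0.
split.
  move=> x y; rewrite !grad_schain -scalerBr.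
  apply: le_trans (_ : 24 * (al / la ^+ 2) * enorm (x - y) <= _); last first.
    by rewrite ler_wpM2r// sqrtr_ge0.
  apply: enorm_le_sqr; first by rewrite mulr_ge0// divr_ge0// exprn_ge0.
  rewrite !enorm_sqr.
  have H := dchain_lip (la^-1 *: x) (la^-1 *: y).
  have E1 : \sum_(j < d) ((al / la) *: (dchain (la^-1 *: x) - dchain (la^-1 *: y))) ord0 j ^+ 2 =
    (al / la) ^+ 2 * \sum_(j < d) (dchain (la^-1 *: x) ord0 j - dchain (la^-1 *: y) ord0 j) ^+ 2.
    by rewrite mulr_sumr; apply: eq_bigr => j _; rewrite !mxE exprMn.
  have E2 : \sum_(j < d) ((la^-1 *: x) ord0 j - (la^-1 *: y) ord0 j) ^+ 2 =
    la^-1 ^+ 2 * \sum_(j < d) ((x - y) ord0 j) ^+ 2.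
    by rewrite mulr_sumr; apply: eq_bigr => j _; rewrite !mxE -exprMn mulrBr.
  rewrite E1; move: H; rewrite E2 => H.
  apply: le_trans (ler_wpM2l (sqr_ge0 _) H) _.
  rewrite le_eqVlt; apply/orP; left; apply/eqP.
  by field; rewrite gt_eqF.
have f0 : ((schain al la (0 : 'rV[R]_d))%:E <= 0%:E)%E.
  by rewrite lee_fin /schain scaler0 mulr_ge0_le0// chain0_le0.
have fi : ((- Delta)%:E <= ereal_inf (range (fun x : 'rV[R]_d => (schain al la x)%:E)))%E.
  apply: le_ereal_inf_tmp => _ [x _ <-]; rewrite lee_fin /schain.
  apply: le_trans (_ : al * - d.+1%:R <= _); first by rewrite mulrN lerN2.
  by rewrite ler_wpM2l// chain_ge.
by apply: le_trans (leeB f0 fi) _; rewrite EFinN oppeK add0e.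
Qed.

(** * Progress of a point and the Bernoulli oracle *)

Definition prog d (x : 'rV[R]_d) : nat := \max_(j < d | x ord0 j != 0) j.+1.

Lemma prog_leP d (x : 'rV[R]_d) m :
  reflect (forall j : 'I_d, (m <= j)%N -> x ord0 j = 0) (prog x <= m)%N.
Proof.
apply: (iffP (bigmax_leqP _ _ _)) => H j.
  by move=> mj; apply/eqP/negPn/negP => /H; rewrite ltnNge mj.
by move=> xj; rewrite ltnNge; apply: contra xj => /H ->.
Qed.

Lemma prog0 d : prog (0 : 'rV[R]_d) = 0%N.
Proof. by apply/eqP; rewrite -leqn0; apply/prog_leP => j _; rewrite mxE. Qed.

Lemma prog_le_dim d (x : 'rV[R]_d) : (prog x <= d)%N.
Proof. by apply/prog_leP => j; rewrite leqNgt ltn_ord. Qed.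

Lemma prog_scale d (x : 'rV[R]_d) (a : R) : (prog (a *: x) <= prog x)%N.
Proof. by apply/prog_leP => j /(elimT (prog_leP x _) (leqnn _)) xj; rewrite mxE xj mulr0. Qed.

Lemma prog_subset d (x : 'rV[R]_d) (gs : seq 'rV[R]_d) m :
  supp x \subset \bigcup_(v <- gs) supp v -> (forall g, g \in gs -> (prog g <= m)%N) ->
  (prog x <= m)%N.
Proof.
move=> xs H; apply/prog_leP => j mj; apply/eqP/negPn/negP => xj.
have /(fintype.subsetP xs) : j \in supp x by rewrite inE.
elim: gs H {xs} => [|g gs IH] H; first by rewrite big_nil inE.
rewrite big_cons inE => /orP[|]; last first.
  by apply: IH => h hg; apply: H; rewrite inE hg orbT.
rewrite inE => /negP; apply; apply/eqP.
by apply: (elimT (prog_leP g m)) => //; apply: H; rewrite mem_head.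
Qed.

Lemma ncoord_prog d (x : 'rV[R]_d) k : (prog x <= k)%N -> ncoord x k = 0.
Proof.
move=> /prog_leP H; have [kd|] := ltnP k d; last exact: ncoord_out.
by rewrite -[k]/(nat_of_ord (Ordinal kd)) ncoord_ord; exact: H.
Qed.

Lemma dchain_prog d (x : 'rV[R]_d) : (prog (dchain x) <= (prog x).+1)%N.
Proof.
apply/prog_leP => j pj; apply: dchain_zero; last by apply: ncoord_prog; exact: ltnW.
by case: j pj => -[//|j] /= jd; rewrite ltnS => pj; exact: ncoord_prog.
Qed.

Lemma grad_schain_large d (al la : R) (x : 'rV[R]_d) : 0 < al -> 0 < la ->
  (prog x < d)%N -> (al / la) ^+ 2 / 16 <= enorm (grad (schain al la (d := d)) x) ^+ 2.
Proof.
move=> al0 la0 xd; have d0 := leq_ltn_trans (leq0n _) xd.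
have [|j Hj] := @dchain_large _ d (la^-1 *: x) d0.
  by apply: ncoord_prog; rewrite (leq_trans (prog_scale _ _))// -ltnS prednK.
rewrite enorm_sqr (bigD1 j)//=.
apply: le_trans (_ : grad (schain al la (d := d)) x ord0 j ^+ 2 <= _); last first.
  by rewrite lerDl sumr_ge0// => k _; exact: sqr_ge0.
rewrite grad_schain mxE [leRHS]exprMn ler_wpM2l ?sqr_ge0//.
have -> : 16^-1 = (1 / 4) ^+ 2 :> R by field.
by rewrite -[leRHS]sqrrN lerXn2r ?nnegrE//; lra.
Qed.

Definition bern_oracle d (f : 'rV[R]_d -> R) (p : R) (x : 'rV[R]_d) (b : bool) : 'rV[R]_d :=
  \row_j (grad f x ord0 j * (if (prog x <= j)%N then b%:R / p else 1)).

(** A failed coin multiplies everything beyond the progress of [x] by 0; after a success the chain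
    property still allows only one new coordinate. *)
Lemma prog_bern_oracle d (al la p : R) (x : 'rV[R]_d) b :
  (prog (bern_oracle (schain al la (d := d)) p x b) <= prog x + b)%N.
Proof.
have A := elimT (prog_leP _ _) (dchain_prog (la^-1 *: x)).
apply/prog_leP => j; rewrite mxE grad_schain mxE; case: b => xj.
  rewrite A ?mulr0 ?mul0r//; apply: leq_trans xj.
  by rewrite addn1 ltnS prog_scale.
by rewrite addn0 in xj; rewrite xj mul0r mulr0.
Qed.

Lemma bern_integral (p : R) (h : bool -> R) : 0 <= p <= 1 -> (forall b, 0 <= h b) ->
  (bernoulli_prob p).-integrable setT (fun b => (h b)%:E) /\
  (\int[bernoulli_prob p]_b (h b)%:E = (p * h true + (1 - p) * h false)%:E)%E.
Proof.
move=> p01 h0; have E := @integral_bernoulli_prob R p p01 (fun b => (h b)%:E).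
have {}E : (\int[bernoulli_prob p]_b (h b)%:E = (p * h true + (1 - p) * h false)%:E)%E.
  by rewrite E// => b; rewrite lee_fin.
split=> //; apply/integrableP; split; first by [].
rewrite (eq_integral (fun b => (h b)%:E)) ?E ?ltry// => b _.
by rewrite gee0_abs ?lee_fin.
Qed.

Lemma bern_admissible n d (al la p sigma2 : R) :
  0 < p <= 1 -> (al / la) ^+ 2 * (3 / 8) ^+ 2 * ((1 - p) / p) <= sigma2 ->
  admissible (fun _ : 'I_n => bernoulli_prob p : probability bool R)
    (bern_oracle (schain al la (d := d)) p) (schain al la (d := d)) sigma2.
Proof.
move=> /andP[p0 p1] hs x i; have p01 : 0 <= p <= 1 by rewrite ltW.
set g := grad _ x; split.
  move=> j; pose h (b : bool) : R := if (prog x <= j)%N then b%:R / p else 1.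
  have h0 b : 0 <= h b by rewrite /h; case: ifP => // _; rewrite divr_ge0// ltW.
  have [hi hE] := bern_integral p01 h0.
  have -> : (fun b => ((bern_oracle (schain al la (d := d)) p x b) ord0 j)%:E) =
            (fun b => (g ord0 j)%:E * (h b)%:E)%E.
    by apply/funext => b; rewrite mxE EFinM.
  split; first exact: integrableZl.
  rewrite integralZl// hE -EFinM (_ : _ + _ = 1) ?mulr1// /h.
  case: ifP => _; last by rewrite !mulr1 addrC subrK.
  by rewrite mul0r mulr0 addr0 mul1r mulfV ?gt_eqF.
(* [c] is the only noisy entry of the gradient, with default 0 when [prog x] is [d] and no
   coordinate remains. *)
pose j0 := insub (prog x) : option 'I_d.
pose c := oapp (g ord0) 0 j0.
have cE : c ^+ 2 <= (al / la) ^+ 2 * (3 / 8) ^+ 2.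
  rewrite /c /j0; case: insubP => /= [j _ jE|_]; last first.
    by rewrite expr0n mulr_ge0 ?sqr_ge0.
  rewrite /g grad_schain mxE [leLHS]exprMn ler_wpM2l ?sqr_ge0// dchain_frontier// ncoord_prog//.
  by rewrite jE prog_scale.
pose h (b : bool) : R := c ^+ 2 * (b%:R / p - 1) ^+ 2.
have h0 b : 0 <= h b by rewrite mulr_ge0 ?sqr_ge0.
have [_ hE] := bern_integral p01 h0.
have nE b : enorm (bern_oracle (schain al la (d := d)) p x b - g) ^+ 2 = h b.
  have bE k : (bern_oracle (schain al la (d := d)) p x b - g) ord0 k =
      g ord0 k * ((if (prog x <= k)%N then b%:R / p else 1) - 1).
    by rewrite mulrBr mulr1 [LHS]mxE [(- g) _ _]mxE [bern_oracle _ _ _ _ _ _]mxE.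
  rewrite enorm_sqr /h /c /j0; case: insubP => /= [j _ jE|].
    rewrite (bigD1 j)//= big1 ?addr0 => [|k kj].
      by rewrite bE jE leqnn exprMn.
    rewrite bE; case: leqP => pk; last by rewrite subrr mulr0 expr0n.
    suff -> : g ord0 k = 0 by rewrite mul0r expr0n.
    rewrite /g grad_schain mxE (elimT (prog_leP _ _) (dchain_prog _)) ?mulr0//.
    rewrite (leq_trans _ (_ : (prog x).+1 <= k)%N) ?ltnS ?prog_scale//.
    by rewrite ltn_neqAle pk andbT -jE eq_sym.
  rewrite -leqNgt => dp; rewrite big1 ?expr0n ?mul0r// => k _.
  by rewrite bE leqNgt (leq_trans (ltn_ord k) dp)/= subrr mulr0 expr0n.
under eq_integral do rewrite nE.
rewrite hE lee_fin /h (_ : true%:R = 1 :> R)// (_ : false%:R = 0 :> R)//.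
apply: le_trans hs.
rewrite [leLHS](_ : _ = c ^+ 2 * ((1 - p) / p)); last by field; rewrite gt_eqF.
by rewrite ler_wpM2r// divr_ge0 ?subr_ge0// ltW.
Qed.

(** * Levels of a run *)
(* The state of the protocol together with the bookkeeping of the argument: the
   progress level, the time at which it was reached, and for each oracle the
   number of gradients computed entirely within the current level. *)
Record lstate (n d : nat) := LState {
  l_hist : seq 'rV[R]_d;
  l_st : 'I_n -> ostate d;
  l_lvl : nat;
  l_beg : R;
  l_cnt : 'I_n -> nat }.

Section leveled_run.
Context {n d : nat} (A : algo n d) (G : 'rV[R]_d -> bool -> 'rV[R]_d) (tau : 'I_n -> R) (N : nat).
Implicit Type s : lstate n d.

Definition called s : 'I_n := algo_oracle A (l_hist s).

(** No other call can raise the progress: before completion an oracle returns 0, and a gradient at a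
    point of lower progress cannot pass the level. *)
Definition live s : bool :=
  [&& (l_st s (called s)).2,
      (l_st s (called s)).1.1 + tau (called s) <= algo_time A (l_hist s),
      prog (l_st s (called s)).1.2 == l_lvl s & (l_lvl s < d)%N].

(** The first [N - 1] live gradients of a level; a success among them makes the level fast. *)
Definition counted s : bool := live s && ((\sum_i l_cnt s i).+1 < N)%N.

(** A live success raises the level even if the gradient happens to show no new nonzero entry, so
    the level is an upper bound for the progress. *)
Definition lstep s (x : 'I_n -> bool) : lstate n d :=
  let: (s', g) := delayed_oracle G (tau (called s)) (algo_time A (l_hist s))
     (algo_point A (l_hist s)) (l_st s (called s)) (x (called s)) in
  let h := rcons (l_hist s) g in
  let st := fun j => if j == called s then s' else l_st s j in
  if live s then
    if x (called s) then LState h st (l_lvl s).+1 (algo_time A (l_hist s)) (fun _ => 0%N)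
    else LState h st (l_lvl s) (l_beg s) (fun j => l_cnt s j + (j == called s))%N
  else LState h st (l_lvl s) (l_beg s) (l_cnt s).

Fixpoint lrun (xi : nat -> 'I_n -> bool) (k : nat) : lstate n d :=
  if k is k'.+1 then lstep (lrun xi k') (xi k')
  else LState [::] (fun _ => (0, 0, false)) 0 0 (fun _ => 0%N).

Definition nfast xi k : nat := \sum_(j < k) (counted (lrun xi j) && xi j (called (lrun xi j))).
Definition ncounted xi k : nat := \sum_(j < k) counted (lrun xi j).

Lemma lrun_run xi k : run A G tau xi k = (l_hist (lrun xi k), l_st (lrun xi k)).
Proof.
elim: k => //= k ->; rewrite /lstep /called /algo_oracle /algo_time /algo_point.
case: (A _) => [[t i] x] /=; case: (delayed_oracle _ _ _ _ _ _) => s' g.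
by case: (live _) => //; case: (xi k _).
Qed.

Lemma lrun_ext xi xi' k : (forall j, (j < k)%N -> xi j = xi' j) -> lrun xi k = lrun xi' k.
Proof.
elim: k => //= k IH H; rewrite IH => [|j jk]; last by rewrite H// ltnW.
by rewrite H.
Qed.

Variable ts : R.
Hypothesis vA : valid_algo A.
Hypothesis zA : zero_respecting A.
Hypothesis GP : forall x b, (prog (G x b) <= prog x + b)%N.
Hypothesis ts0 : 0 <= ts.
(** Each oracle works on one gradient at a time, so [ts] is a lower bound for the time in which [N]
    gradients can be computed from scratch. *)
Hypothesis tsP : forall (e : 'I_n -> nat) (delta : R),
  (forall i, (e i)%:R * tau i <= delta) -> (N <= \sum_i e i)%N -> ts <= delta.

(** [F] and [C] stand for [nfast] and [ncounted]. [inv_fast] charges time [ts] to each finished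
    level that is not fast. By [inv_busy], work on a point of the current level began after the
    gradients that this oracle already computed in the level. *)
Record linv s (now : R) (F C : nat) : Prop := LInv {
  inv_hist : forall g, g \in l_hist s -> (prog g <= l_lvl s)%N;
  inv_now : l_beg s <= now;
  inv_lvl : (l_lvl s <= d)%N;
  inv_cnt : forall i, l_beg s + (l_cnt s i)%:R * tau i <= now;
  inv_busy : forall i, (l_st s i).2 -> (prog (l_st s i).1.2 <= l_lvl s)%N /\
    (prog (l_st s i).1.2 = l_lvl s -> l_beg s + (l_cnt s i)%:R * tau i <= (l_st s i).1.1);
  inv_fast : ts * ((l_lvl s)%:R - F%:R) <= l_beg s;
  inv_counted : (C <= N.-1 * l_lvl s + minn (\sum_i l_cnt s i) N.-1)%N }.

Lemma linv_step s now F C x : linv s now F C -> now <= algo_time A (l_hist s) ->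
  linv (lstep s x) (algo_time A (l_hist s)) (F + (counted s && x (called s))) (C + counted s).
Proof.
move=> [ih inow il ic ib ifa ico] nt.
have ppt : (prog (algo_point A (l_hist s)) <= l_lvl s)%N.
  exact: prog_subset (zA _) ih.
have ct j : l_beg s + (l_cnt s j)%:R * tau j <= algo_time A (l_hist s) by rewrite (le_trans (ic j)).
have bt := le_trans inow nt.
rewrite /lstep /counted /live; set i := called s; set t := algo_time A _ in nt ct bt *.
have := ib i; case Es : (l_st s i) => [[st sx] sq] /=.
case: sq Es => Es /=; last first.
  move=> _; split=> //=; rewrite ?addn0//.
    by move=> g; rewrite mem_rcons inE => /orP[/eqP->|/ih//]; rewrite prog0.
  by move=> j; case: eqP => [->|_ /ib//] /= _; split.
move=> /(_ isT) [psx ist].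
rewrite ltNge; case: leP => tst /=; last first.
  split=> //=; rewrite ?addn0//.
    by move=> g; rewrite mem_rcons inE => /orP[/eqP->|/ih//]; rewrite prog0.
  by move=> j; case: eqP => [->|_ /ib//] /= _; split.
have histP m : (l_lvl s <= m)%N -> (prog (G sx (x i)) <= m)%N ->
    forall g, g \in rcons (l_hist s) (G sx (x i)) -> (prog g <= m)%N.
  move=> lm gm g; rewrite mem_rcons inE => /orP[/eqP->//|/ih gl].
  exact: leq_trans gl lm.
(* A gradient that is not live: either the level is [d], or its point has lower progress and one
   more coordinate stays within the level. *)
case: ifP => [/andP[/eqP lsx ld]|nl]; last first.
  split=> //=; rewrite ?addn0//; last by move=> j; case: eqP => // _ /ib.
  apply: histP => //; have [dl|ld] := leqP d (l_lvl s).
    exact: leq_trans (prog_le_dim _) dl.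
  apply: leq_trans (GP _ _) _; move: psx; rewrite leq_eqVlt => /orP[E|lt].
    by rewrite E ld in nl.
  by apply: leq_trans lt; rewrite -addn1 leq_add2l leq_b1.
(* The gradient took time [tau i] from its start, which by [inv_busy] came after the earlier
   [l_cnt s i] ones. *)
have ici : l_beg s + (l_cnt s i).+1%:R * tau i <= t.
  by rewrite -natr1 mulrDl mul1r addrA (le_trans _ tst)// lerD2r ist.
have GPx := GP sx (x i).
have cntP j : l_beg s + (l_cnt s j + (j == i))%:R * tau j <= t.
  by case: eqP => [->|_]; rewrite ?addn1// addn0.
have sumP : (\sum_j (l_cnt s j + (j == i)) = (\sum_j l_cnt s j).+1)%N.
  rewrite big_split/= -addn1; congr (_ + _)%N.
  by rewrite (bigD1 i)//= eqxx big1 ?addn0// => j /negbTE->.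
case: (x i) GPx histP => GPx histP /=; split=> //=.
- by apply: histP => //; rewrite -lsx -addn1.
- by move=> j; rewrite mul0r addr0.
(* Pending requests are at points of at most the old level, so none is at the new one. *)
- move=> j; case: eqP => // _ /ib[pj _]; split; first exact: leqW.
  by move=> E; move: pj; rewrite E ltnn.
(* If the ending level is fast, [F] grows with the level and the bound is unchanged. Otherwise the
   level contains at least [N] gradients, hence took time [ts] by [tsP]. *)
- rewrite andbT; case: ltnP => sN.
    rewrite addn1 -!natr1 (_ : _ + 1 - _ = (l_lvl s)%:R - F%:R); last by ring.
    exact: le_trans ifa bt.
  rewrite addn0 -natr1 (_ : _ + 1 - _ = (l_lvl s)%:R - F%:R + 1); last by ring.
  rewrite mulrDr mulr1; have : ts <= t - l_beg s.
    apply: (tsP (e := fun j => l_cnt s j + (j == i))%N); last by rewrite sumP.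
    by move=> j; rewrite lerBrDl.
  lra.
(* The counters restart, and the at most [N - 1] counted gradients of the level just ended move into
   the product. *)
- rewrite (_ : (\sum_(j < n) 0 = 0)%N) ?min0n ?addn0 ?mulnS; last by rewrite big1.
  move: ico; case: ltnP; move: (N.-1 * l_lvl s)%N (\sum_j l_cnt s j)%N => a S /=;
    rewrite ?addn1 ?addn0; lia.
- by apply: histP => //; rewrite addn0 in GPx; exact: leq_trans GPx psx.
- move=> j; case: eqP => // ji /ib[pj bj]; rewrite addn0; split=> //.
- by rewrite andbF addn0.
- rewrite sumP; move: ico; case: ltnP; move: (N.-1 * l_lvl s)%N (\sum_j l_cnt s j)%N => a S /=;
    rewrite ?addn1 ?addn0; lia.
Qed.

Lemma proto_tS xi k : proto_t A G tau xi k.+1 = algo_time A (l_hist (lrun xi k)).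
Proof. by rewrite /proto_t lrun_run. Qed.

Lemma proto_t_le xi k : proto_t A G tau xi k <= proto_t A G tau xi k.+1.
Proof.
rewrite proto_tS; case: k => [|k]; first exact: vA.1.
rewrite proto_tS /= /lstep; case: (delayed_oracle _ _ _ _ _ _) => s' g.
have [_ vA2] := vA; case: (live _) => /=; first case: (xi k _) => /=; exact: vA2.
Qed.

Lemma lrun_inv xi k : linv (lrun xi k) (proto_t A G tau xi k) (nfast xi k) (ncounted xi k).
Proof.
elim: k => [|k IH].
  split=> //=; rewrite ?lexx//; first by move=> i; rewrite mul0r addr0.
    by rewrite /nfast big_ord0 subrr mulr0.
  by rewrite /ncounted big_ord0.
rewrite proto_tS /nfast /ncounted !big_ord_recr /=.
by apply: linv_step IH _; have := proto_t_le xi k; rewrite proto_tS.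
Qed.

Lemma ncounted_le xi k : (ncounted xi k <= N.-1 * d.+1)%N.
Proof.
have [_ _ il _ _ _ /leq_trans] := lrun_inv xi k; apply.
by rewrite mulnS addnC leq_add ?geq_minr// leq_mul2l il orbT.
Qed.

(** Level [d] with fewer than [d / 2] fast levels would have begun after time [ts * (d / 2)]. *)
Lemma proto_x_prog xi k t : (0 < d)%N -> 0 < ts ->
  proto_t A G tau xi k <= t -> t < ts * (d%:R / 2) ->
  (nfast xi k)%:R < d%:R / 2 :> R -> (prog (proto_x A G tau xi k) < d)%N.
Proof.
move=> d0 ts_gt0 kt tT Fd; have [ih inow il _ _ ifa _] := lrun_inv xi k.
have : (l_lvl (lrun xi k) < d)%N.
  rewrite ltn_neqAle il andbT; apply/eqP => E; rewrite E in ifa.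
  have : ts * (d%:R - (nfast xi k)%:R) < ts * (d%:R / 2).
    by apply: le_lt_trans tT; rewrite (le_trans ifa)// (le_trans inow).
  by rewrite ltr_pM2l//; move: Fd; lra.
apply: leq_ltn_trans; rewrite /proto_x lrun_run /=.
exact: prog_subset (zA _) ih.
Qed.
End leveled_run.

(** * Time and probability estimates *)
Section time_bound.
Context {n : nat} (tau : 'I_n -> R).
Hypothesis tau0 : forall i, 0 < tau i.

Lemma sum_inv_gt0 m : (0 < n)%N -> (0 < m)%N -> 0 < \sum_(i < n | (i < m)%N) (tau i)^-1.
Proof.
move=> n0 m0; rewrite (bigD1 (Ordinal n0))//= ltr_pwDl ?invr_gt0// sumr_ge0// => i _.
by rewrite invr_ge0 ltW.
Qed.

Lemma tbound_gt0 (sigma2 L Delta eps : R) : (0 < n)%N -> 0 < sigma2 -> 0 < L -> 0 < Delta ->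
  0 < eps -> 0 < tbound tau sigma2 L Delta eps.
Proof.
move=> n0 s0 L0 D0 e0.
have H m : (0 < m)%N -> 0 < tbound_term tau sigma2 L Delta eps m.
  move=> m0; rewrite /tbound_term mulr_gt0//.
    by rewrite invr_gt0 mulr_gt0 ?sum_inv_gt0// invr_gt0 ltr0n.
  by rewrite addr_gt0// divr_gt0// ?mulr_gt0// ?ltr0n ?exprn_gt0.
by apply: lt_bigmin => [|i _]; exact: H.
Qed.

Lemma time_for_samples (sigma2 L Delta eps : R) (N : nat) : 0 < sigma2 -> 0 < L -> 0 < Delta ->
  0 < eps -> (forall i j : 'I_n, (i <= j)%N -> tau i <= tau j) ->
  (0 < N)%N -> sigma2 / (72 * eps) <= N%:R ->
  forall (e : 'I_n -> nat) (delta : R),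
  (forall i, (e i)%:R * tau i <= delta) -> (N <= \sum_i e i)%N ->
  tbound tau sigma2 L Delta eps * (eps / (144 * (L * Delta))) <= delta.
Proof.
move=> s0 L0 D0 e0 tauS N0 sN e delta He HN.
have [i1 ei1] : exists i, (0 < e i)%N.
  apply/existsP; rewrite -[X in is_true X]negbK negb_exists; apply/negP => /forallP H.
  move: HN; rewrite big1 => [|i _]; first by rewrite leqNgt N0.
  by apply/eqP; rewrite -leqn0 leqNgt H.
(* [i0] is the last oracle in use; the minimum is tested at [m = i0.+1]. *)
pose i0 := [arg max_(i > i1 | (0 < e i)%N) (i : nat)].
have [ei0 i0max] : (0 < e i0)%N /\ (forall j, (0 < e j)%N -> (j <= i0)%N).
  by rewrite /i0; case: arg_maxnP.
have d0 : tau i0 <= delta.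
  by apply: le_trans (He i0); rewrite -[leLHS]mul1r ler_wpM2r ?ler1n// ltW.
set m := i0.+1; set W := \sum_(i < n | (i < m)%N) (tau i)^-1.
have n0 : (0 < n)%N by exact: leq_ltn_trans (ltn_ord i0).
have W0 : 0 < W by exact: sum_inv_gt0.
have dW (a : 'I_n -> nat) : (forall i : 'I_n, (i < m)%N -> (a i)%:R * tau i <= delta) ->
    (\sum_(i < n | (i < m)%N) a i)%:R <= delta * W.
  move=> Ha; rewrite natr_sum mulr_sumr; apply: ler_sum => i im.
  by rewrite ler_pdivlMr// Ha.
(* The times are sorted, so each of the first [m] oracles could deliver one gradient within
   [delta]. *)
have dm : m%:R <= delta * W.
  rewrite -[m](_ : \sum_(i < n | (i < m)%N) 1 = _)%N; last first.
    by rewrite (big_ord_narrow (ltn_ord i0)) sum1_card card_ord.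
  by apply: dW => i im; rewrite mul1r (le_trans (tauS _ _ im)).
have dN : N%:R <= delta * W.
  apply: le_trans (_ : (\sum_(i < n | (i < m)%N) e i)%:R <= _); last by apply: dW.
  rewrite ler_nat (leq_trans HN)// (bigID (fun i : 'I_n => (i < m)%N))/=.
  rewrite [X in (_ + X)%N]big1 ?addn0// => i; rewrite -leqNgt => mi.
  by apply/eqP; rewrite -leqn0 leqNgt; apply/negP => /i0max; rewrite leqNgt mi.
have m0 : 0 < m%:R :> R by rewrite ltr0n.
apply: le_trans (_ : tbound_term tau sigma2 L Delta eps m * (eps / (144 * (L * Delta))) <= _).
  apply: ler_wpM2r; first by rewrite ltW// divr_gt0// !mulr_gt0.
  exact: (@bigmin_inf _ _ _ _ i0).
rewrite (_ : tbound_term _ _ _ _ _ _ * _ = (m%:R + sigma2 / eps) / (144 * W)); last first.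
  by rewrite /tbound_term -/W; field; rewrite !gt_eqF.
rewrite ler_pdivrMr ?mulr_gt0//.
(* [m + sigma2 / eps] is at most [m + 72 * N], hence at most 73 times [delta * W], within the
   allowed 144. *)
have : sigma2 / eps <= 72 * N%:R.
  by move: sN; rewrite !ler_pdivrMr ?mulr_gt0//; lra.
have := dN; have := dm; lra.
Qed.
End time_bound.

(** * Two measure-theoretic estimates *)

Section measure_lemmas.
Context {K : realType} {dO : measure_display} {O : measurableType dO} (P : probability O K).

(** [c] times the indicator of [B] is a simple function below [f], and the integral is a supremum
    over such functions. It serves both as Markov's inequality and for the final bound on
    [outcome]. *)
Lemma integral_ge_cst_on (f : O -> \bar K) (c : K) (B : set O) : measurable B -> 0 <= c ->
  (forall w, 0 <= f w)%E -> (forall w, B w -> c%:E <= f w)%E ->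
  (c%:E * P B <= \int[P]_w f w)%E.
Proof.
move=> mB c0 f0 fB; rewrite ge0_integralTE//.
apply: ereal_sup_ubound => /=; exists (scale_nnsfun (indic_nnsfun K mB) c0).
  move=> w; rewrite -[leLHS]/((c * \1_B w)%:E) indicE; case: (boolP (w \in B)) => [/set_mem /fB|_].
    by rewrite mulr1.
  by rewrite mulr0.
rewrite -[P B](sintegral_indic P B).
exact: (sintegralrM P c (indic_nnsfun K mB)).
Qed.

Lemma measure_bigcup_nondecreasing_le (F : (set O)^nat) (c : \bar K) :
  (forall k, measurable (F k)) -> nondecreasing_seq F -> (forall k, P (F k) <= c)%E ->
  (P (\bigcup_k F k) <= c)%E.
Proof.
move=> mF ndF Fc.
have H := @nondecreasing_cvg_mu _ _ _ P F mF (bigcup_measurable (fun k _ => mF k)) ndF.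
rewrite -(cvg_lim _ H)//; apply: lime_le; first by apply: cvgP H.
by apply: nearW => k; exact: Fc.
Qed.
End measure_lemmas.

(** * Independent coins and events decided by the first rounds *)

Section coins.
Context {K : realType} {n : nat} {dO : measure_display} {O : measurableType dO}
  (P : probability O K).
Context (p : K) (xi : nat -> 'I_n -> O -> bool).
Hypothesis p01 : 0 <= p <= 1.
Hypothesis xi_meas : forall k i, measurable_fun setT (xi k i).
Hypothesis xi_dist : forall k i B, measurable B -> P (xi k i @^-1` B) = bernoulli_prob p B.
Hypothesis xi_indep : forall (s : seq (nat * 'I_n)) (B : nat -> 'I_n -> set bool), uniq s ->
  (forall q, q \in s -> measurable (B q.1 q.2)) ->
  P (\big[setI/setT]_(q <- s) (xi q.1 q.2 @^-1` B q.1 q.2)) =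
  (\prod_(q <- s) P (xi q.1 q.2 @^-1` B q.1 q.2))%E.

Definition coins w : nat -> 'I_n -> bool := fun k i => xi k i w.

Definition first_coins k w : {ffun 'I_k * 'I_n -> bool} := [ffun q : 'I_k * 'I_n => xi q.1 q.2 w].

Definition extend_coins k (v : {ffun 'I_k * 'I_n -> bool}) : nat -> 'I_n -> bool :=
  fun j i => oapp (fun j' => v (j', i)) false (insub j).

Definition determined_by k (Q : (nat -> 'I_n -> bool) -> bool) :=
  forall c c', (forall j, (j < k)%N -> c j = c' j) -> Q c = Q c'.

Lemma extend_first_coins k w j : (j < k)%N -> coins w j = extend_coins (first_coins k w) j.
Proof.
by move=> jk; apply/funext => i; rewrite /extend_coins insubT /= ffunE.
Qed.

(** The atoms of the finite algebra generated by the first [k] rounds. Each is an intersection of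
    one condition per cell, the form in which independence is assumed. *)
Let atom k (v : {ffun 'I_k * 'I_n -> bool}) := [set w | first_coins k w = v].
Let box k (v : {ffun 'I_k * 'I_n -> bool}) (j : nat) (i : 'I_n) : set bool :=
  [set extend_coins v j i].
Let cells k := [seq (nat_of_ord q.1, q.2) | q <- enum {: 'I_k * 'I_n}].

Lemma atomE k (v : {ffun 'I_k * 'I_n -> bool}) :
  atom v = \big[setI/setT]_(q <- cells k) (xi q.1 q.2 @^-1` box v q.1 q.2).
Proof.
rewrite -bigcap_seq; apply/seteqP; split=> w /=.
  move=> <- q /= /mapP[[j i] _ -> /=].
  by rewrite /box /= -extend_first_coins.
move=> H; apply/ffunP => -[j i]; rewrite ffunE /=.
have /H : (nat_of_ord j, i) \in cells k.
  by apply/mapP; exists (j, i) => //; rewrite mem_enum.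
by rewrite /box /= /extend_coins valK.
Qed.

Lemma measurable_coin k i (B : set bool) : measurable (xi k i @^-1` B).
Proof. by rewrite -[X in measurable X]setTI; apply: xi_meas. Qed.

Lemma measurable_atom k (v : {ffun 'I_k * 'I_n -> bool}) : measurable (atom v).
Proof. by rewrite atomE; apply: bigsetI_measurable => q _; exact: measurable_coin. Qed.

Lemma uniq_cells k : uniq (cells k).
Proof.
rewrite map_inj_uniq ?enum_uniq// => -[j i] [j' i'] /= [jj' ->].
by congr (_, _); exact: val_inj.
Qed.

Lemma atom_coin k (v : {ffun 'I_k * 'I_n -> bool}) i :
  (P (atom v `&` xi k i @^-1` [set true]) = p%:E * P (atom v))%E.
Proof.
have kc : (k, i) \notin cells k.
  apply/negP => /mapP[[j i'] _ /= [kj _]].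
  by have := ltn_ord j; rewrite -kj ltnn.
(* Independence is applied to [cells k] enlarged by [(k, i)]: the conditions of the atom in earlier
   rounds and success in round [k]. *)
pose B j i' := if j == k then [set true] else box v j i'.
have BE q : q \in cells k -> xi q.1 q.2 @^-1` B q.1 q.2 = xi q.1 q.2 @^-1` box v q.1 q.2.
  move=> /mapP[[j i'] _ -> /=]; rewrite /B ifF//; apply/negbTE.
  by rewrite neq_ltn ltn_ord.
have := @xi_indep ((k, i) :: cells k) B.
rewrite /= kc uniq_cells => /(_ isT (fun _ _ => Logic.I)).
rewrite !big_cons /= {1 3}/B eqxx.
rewrite (eq_big_seq _ BE) -atomE.
rewrite (eq_big_seq (fun q => P (xi q.1 q.2 @^-1` box v q.1 q.2))); last first.
  by move=> q qc; rewrite BE.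
rewrite -xi_indep ?uniq_cells// -atomE setIC => ->.
rewrite xi_dist//; congr (_ * _)%E.
by rewrite bernoulli_probE// !diracE mem_set// memNset ?mule1 ?mule0 ?adde0.
Qed.

Lemma determined_bigcup k Q U : determined_by k Q ->
  [set w | Q (coins w)] `&` U =
  \bigcup_(v in [set v | Q (@extend_coins k v)]) (atom v `&` U).
Proof.
move=> dQ; apply/seteqP; split=> w /=.
  move=> [Qw Uw]; exists (first_coins k w) => //=.
  by rewrite -(dQ (coins w))// => j; exact: extend_first_coins.
move=> [v /= Qv [H Uw]]; split=> //.
by rewrite (dQ _ (extend_coins v))// -H => j; exact: extend_first_coins.
Qed.

Lemma measurable_determined k Q : determined_by k Q -> measurable [set w | Q (coins w)].
Proof.
move=> dQ; rewrite -[X in measurable X]setIT (determined_bigcup _ dQ).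
apply: fin_bigcup_measurable; first exact: finite_finset.
by move=> v _; apply: measurableI => //; exact: measurable_atom.
Qed.

(** An event decided before round [k] is a finite disjoint union of atoms, over which [atom_coin] is
    summed. *)
Lemma determined_coin k Q i : determined_by k Q ->
  (P ([set w | Q (coins w)] `&` xi k i @^-1` [set true]) = p%:E * P [set w | Q (coins w)])%E.
Proof.
move=> dQ; rewrite -[X in (_ = _ * P X)%E]setIT !(determined_bigcup _ dQ).
have tI U : trivIset [set v | Q (@extend_coins k v)] (fun v => atom v `&` U).
  by move=> v v' _ _ [w [[<- _] [<- _]]].
have fI : finite_set [set v | Q (@extend_coins k v)] by exact: finite_finset.
rewrite !measure_fin_bigcup//; last first.
- by move=> v _; apply: measurableI; [exact: measurable_atom|exact: measurable_coin].
- by move=> v _; apply: measurableI => //; exact: measurable_atom.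
rewrite ge0_mule_fsumr//; apply: eq_fsbigr => v _.
by rewrite (setIT (atom v)); exact: atom_coin.
Qed.

(* Whether a trial takes place, and with which coin, is decided by the earlier
   coins, so the expected number of successes is [p] times that of trials. *)
Lemma expected_successes_le (Q : nat -> (nat -> 'I_n -> bool) -> bool)
    (who : nat -> (nat -> 'I_n -> bool) -> 'I_n) m M :
  (forall j i, determined_by j (fun c => Q j c && (who j c == i))) ->
  (forall c, (\sum_(j < m) Q j c <= M)%N) ->
  (\int[P]_w ((\sum_(j < m) (Q j (coins w) && coins w j (who j (coins w))))%N%:R : K)%:E <=
   (p * M%:R)%:E)%E.
Proof.
move=> dQ QM.
pose V (q : 'I_m * 'I_n) := [set w | Q q.1 (coins w) && (who q.1 (coins w) == q.2)].
pose U (q : 'I_m * 'I_n) := xi q.1 q.2 @^-1` [set true].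
have mV q : measurable (V q) by exact: (measurable_determined (dQ q.1 q.2)).
have mVU q : measurable (V q `&` U q) by apply: measurableI => //; exact: measurable_coin.
(* The called oracle depends on the past; splitting over its possible values leaves coins with fixed
   indices. *)
have splitE (X : bool) (c : 'I_n -> bool) (a : 'I_n) :
    (X && c a : nat) = (\sum_(i < n) (X && (a == i) && c i))%N.
  rewrite (bigD1 a)//= eqxx andbT big1 ?addn0// => i ia.
  by rewrite eq_sym (negbTE ia) andbF.
have E1 w : ((\sum_(j < m) (Q j (coins w) && coins w j (who j (coins w))))%N%:R : K)%:E =
    (\sum_(q : 'I_m * 'I_n) (\1_(V q `&` U q) w : K)%:E)%E.
  rewrite sumEFin; congr (_%:E); rewrite natr_sum.
  rewrite -(pair_bigA _ (fun j i => \1_(V (j, i) `&` U (j, i)) w : K))/=.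
  apply: eq_bigr => j _; rewrite splitE natr_sum; apply: eq_bigr => i _.
  rewrite indicE; congr (_%:R); congr nat_of_bool; apply/idP/idP.
    by move=> /andP[a b]; apply/mem_set.
  by move=> /set_mem[/= -> ].
have E2 w : ((\sum_(j < m) Q j (coins w))%N%:R : K)%:E =
    (\sum_(q : 'I_m * 'I_n) (\1_(V q) w : K)%:E)%E.
  rewrite sumEFin; congr (_%:E); rewrite natr_sum.
  rewrite -(pair_bigA _ (fun j i => \1_(V (j, i)) w : K))/=.
  apply: eq_bigr => j _; rewrite -[Q _ _]andbT (splitE _ (fun=> true) (who j (coins w))).
  rewrite natr_sum; apply: eq_bigr => i _.
  rewrite indicE andbT; congr (_%:R); congr nat_of_bool; apply/idP/idP.
    by move=> a; apply/mem_set.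
  by move=> /set_mem.
rewrite (eq_integral _ _ (fun w _ => E1 w)).
rewrite ge0_integral_sum//; last by move=> q; apply/measurable_EFinP; exact: measurable_indic.
have mS : measurable_fun setT (fun w => \sum_(q : 'I_m * 'I_n) (\1_(V q) w : K)%:E)%E.
  by apply: emeasurable_sum => q; apply/measurable_EFinP; exact: measurable_indic.
have S0 w : (0 <= \sum_(q : 'I_m * 'I_n) (\1_(V q) w : K)%:E)%E.
  by apply: sume_ge0 => q _; rewrite lee_fin.
have SM : (\int[P]_w (\sum_(q : 'I_m * 'I_n) (\1_(V q) w : K)%:E) <= M%:R%:E)%E.
  apply: (@le_trans _ _ (\int[P]_w (cst M%:R%:E w))%E).
    by apply: ge0_le_integral => // w _; rewrite -E2 lee_fin ler_nat QM.
  by rewrite (integral_cst P measurableT) /= (probability_setT P) mule1.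
have p0 : (0 <= p%:E)%E by case/andP: p01; rewrite lee_fin.
rewrite EFinM; apply: le_trans (lee_wpmul2l p0 SM).
rewrite ge0_integral_sum//; last by move=> q; apply/measurable_EFinP; exact: measurable_indic.
rewrite ge0_sume_distrr; last by move=> q _; apply: integral_ge0 => w _; rewrite lee_fin.
apply: lee_sum => q _; rewrite !integral_indic// !setIT.
by rewrite le_eqVlt; apply/orP; left; apply/eqP; exact: (determined_coin q.2 (dQ q.1 q.2)).
Qed.

End coins.

(** * Fast levels are rare *)

Lemma nfast_determined n d (A : algo n d) G tau N k (x : R) :
  determined_by k (fun c => x <= (nfast A G tau N c k)%:R).
Proof.
move=> c c' H; congr (_ <= _%:R); apply: eq_bigr => j _.
by rewrite (@lrun_ext _ _ A G tau c c' j) ?H// => i ij; apply: H; exact: ltn_trans (ltn_ord j).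
Qed.

Lemma counted_determined n d (A : algo n d) G tau N j i :
  determined_by j (fun c => counted A tau N (lrun A G tau c j) &&
                            (called A (lrun A G tau c j) == i)).
Proof. by move=> c c' H; rewrite (@lrun_ext _ _ A G tau _ _ _ H). Qed.

Lemma nfast_nondecreasing n d (A : algo n d) G tau N c k k' : (k <= k')%N ->
  (nfast A G tau N c k <= nfast A G tau N c k')%N.
Proof.
move=> /subnK <-; elim: (k' - k)%N => // m IH; rewrite addSn.
by rewrite /nfast big_ord_recr/= (leq_trans IH)// leq_addr.
Qed.

(** The mean of [nfast] is at most [(d + 1) / 8], hence at most [d / 4], so Markov's inequality at
    [d / 2] gives 1/2 for each [k]. The events increase with [k], so the bound passes to their
    union. *)
Lemma prob_many_fast n d (A : algo n d) (G : 'rV[R]_d -> bool -> 'rV[R]_d)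
    (tau : 'I_n -> R) (N : nat) (ts p : R)
    (dO : measure_display) (O : measurableType dO) (P : probability O R)
    (xi : nat -> 'I_n -> O -> bool) :
  valid_algo A -> zero_respecting A ->
  (forall x (b : bool), (prog (G x b) <= prog x + b)%N) -> 0 <= ts ->
  (forall (e : 'I_n -> nat) (delta : R),
    (forall i, (e i)%:R * tau i <= delta) -> (N <= \sum_i e i)%N -> ts <= delta) ->
  0 <= p <= 1 -> p * N.-1%:R <= 1 / 8 -> (0 < d)%N ->
  sampling (fun _ : 'I_n => bernoulli_prob p : probability bool R) P xi ->
  let slow := ~` \bigcup_k [set w | d%:R / 2 <= (nfast A G tau N (coins xi w) k)%:R :> R] in
  measurable slow /\ ((1 / 2)%:E <= P slow)%E.
Proof.
move=> vA zA GP ts0 tsP p01 pN d0 [xim [xid xii]] /=.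
pose F k := [set w | d%:R / 2 <= (nfast A G tau N (coins xi w) k)%:R :> R].
have mF k : measurable (F k).
  exact: (measurable_determined xim (@nfast_determined _ _ A G tau N k (d%:R / 2))).
have PF k : (P (F k) <= (1 / 2)%:E)%E.
  have d20 : 0 < d%:R / 2 :> R by rewrite divr_gt0// ltr0n.
  have E := expected_successes_le p01 xim xid xii (@counted_determined _ _ A G tau N)
    (fun c => ncounted_le vA zA GP ts0 tsP c k).
  have L := @integral_ge_cst_on R _ _ P (fun w => (nfast A G tau N (coins xi w) k)%:R%:E)
    (d%:R / 2) (F k) (mF k) (ltW d20).
  have {L} := le_trans (L _ _) E.
  rewrite -lee_pdivlMl// => H.
  apply: le_trans (H _ _) _.
  - by move=> w; rewrite lee_fin.
  - by move=> w; rewrite lee_fin.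
  rewrite -EFinM lee_fin natrM mulrA.
  rewrite ler_pdivrMl//.
  have d1 : 1 <= d%:R :> R by rewrite ler1n.
  apply: le_trans (_ : 1 / 8 * d.+1%:R <= _); first by rewrite ler_wpM2r.
  by rewrite -(natr1 d); lra.
have mU : measurable (\bigcup_k F k) by apply: bigcup_measurable.
split; first exact: measurableC.
have := measure_bigcup_nondecreasing_le mF _ PF.
rewrite probability_setC// => H.
rewrite leeBrDr ?fin_num_measure//.
apply: le_trans (leeD (lexx _) (H _)) _; last by rewrite -EFinD lee_fin; lra.
move=> k k' kk'; apply/subsetPset => w /= /le_trans; apply.
by rewrite ler_nat nfast_nondecreasing.
Qed.

Theorem mainTheorem1 :
  exists c c' : R, 0 < c /\ 0 < c' /\
  forall (n : nat) (sigma2 : R) (tau : 'I_n -> R) (L Delta eps : R),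
    (0 < n)%N -> 0 < sigma2 ->
    (forall i, 0 < tau i) -> (forall i j : 'I_n, (i <= j)%N -> tau i <= tau j) ->
    0 < L -> 0 < Delta -> 0 < eps -> eps <= c' * L * Delta ->
  forall A : forall d : nat, algo n d,
    (forall d, valid_algo (A d)) -> (forall d, zero_respecting (A d)) ->
  exists (d : nat) (f : 'rV[R]_d -> R) (dS : measure_display) (S : measurableType dS)
         (D : 'I_n -> probability S R) (G : 'rV[R]_d -> S -> 'rV[R]_d),
    in_F Delta L f /\ admissible D G f sigma2 /\
    forall (dO : measure_display) (O : measurableType dO) (P : probability O R)
           (xi : nat -> 'I_n -> O -> S),
      sampling D P xi ->
      (eps%:E < \int[P]_w outcome (A d) G tau (fun k i => xi k i w) f
                              (c * tbound tau sigma2 L Delta eps)%R)%E.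
Proof.
(* The second constant makes [Y >= 3]; the first is half of the factor found in [ts * (Y / 6)], for
   a strict inequality. *)
exists (1 / (144 * 144 * 128)), (1 / (64 * 72)).
do 2!(split; first by rewrite divr_gt0// !mulr_gt0).
move=> n sigma2 tau L Delta eps n0 s0 tau0 tauS L0 D0 e0 eLD A vA zA.
(* [Y] is [Delta / al] for the scale [al] below; [d.+1] is its integer part, so that the gap fits in
   [Delta]. *)
pose Y := L * Delta / (24 * 64 * eps).
have Y3 : 3 <= Y by rewrite /Y ler_pdivlMr ?mulr_gt0//; lra.
have [/= tY Yt] := andP (truncn_itv (le_trans (ler0n R 3) Y3)).
have t2 : (1 < Num.truncn Y)%N.
  by rewrite -(ltr_nat R); move: Yt; rewrite -natr1; lra.
set d := (Num.truncn Y).-1; have dS : d.+1 = Num.truncn Y by rewrite prednK// ltnW.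
have d0 : (0 < d)%N by rewrite -ltnS dS.
rewrite -dS in tY Yt; rewrite -natr1 in Yt.
have dY : Y / 3 <= d%:R by move: Yt; rewrite -natr1; lra.
have [r r0 er] : exists2 r : R, 0 < r & eps = r ^+ 2.
  by exists (Num.sqrt eps); rewrite ?sqrtr_gt0// sqr_sqrtr// ltW.
(* With these scales [24 * (al / la ^+ 2)] is [L], and [(al / la) ^+ 2 / 16], the lower bound for
   the squared gradient norm below progress [d], is [4 * eps]. *)
pose al := 24 * 64 * eps / L; pose la := 192 * r / L.
have al0 : 0 < al by rewrite divr_gt0// mulr_gt0.
have la0 : 0 < la by rewrite divr_gt0// mulr_gt0.
have ala : (al / la) ^+ 2 = 64 * eps.
  have -> : al / la = 8 * r.
    by rewrite /al er /la; field; rewrite !gt_eqF.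
  by rewrite exprMn er; ring.
have ala2 : 24 * (al / la ^+ 2) <= L.
  by rewrite /al er /la le_eqVlt; apply/orP; left; apply/eqP; field; rewrite !gt_eqF.
(* The solution of [9 * eps * ((1 - p) / p) = sigma2], where [9 * eps] bounds the square of the
   noisy entry. *)
pose p := 9 * eps / (9 * eps + sigma2).
have q0 : 0 < 9 * eps + sigma2 by rewrite addr_gt0// mulr_gt0.
have p0 : 0 < p by rewrite divr_gt0// mulr_gt0.
have p1 : p <= 1 by rewrite ler_pdivrMr// mul1r lerDl ltW.
have p01 : 0 <= p <= 1 by rewrite ltW.
(* [N - 1 <= 1 / (8 * p) < N]: the left half keeps fast levels rare, the right half gives
   [sigma2 / (72 * eps) <= N]. *)
pose N := (Num.truncn (1 / (8 * p))).+1.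
have ip0 : 0 <= 1 / (8 * p) by rewrite divr_ge0// mulr_ge0// ltW.
have [/= tp pt] := andP (truncn_itv ip0).
pose ts := tbound tau sigma2 L Delta eps * (eps / (144 * (L * Delta))).
have tb0 := tbound_gt0 tau0 n0 s0 L0 D0 e0.
have ts0 : 0 < ts by rewrite mulr_gt0// divr_gt0// !mulr_gt0.
have sN : sigma2 / (72 * eps) <= N%:R.
  apply: le_trans (ltW pt); rewrite /p.
  rewrite (_ : 1 / _ = sigma2 / (72 * eps) + 1 / 8) ?lerDl//; last by field; rewrite !gt_eqF.
have tsP := time_for_samples tau0 s0 L0 D0 e0 tauS (isT : (0 < N)%N) sN.
have pN : p * N.-1%:R <= 1 / 8.
  apply: le_trans (ler_wpM2l (ltW p0) tp) _.
  by rewrite le_eqVlt; apply/orP; left; apply/eqP; field; rewrite gt_eqF.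
have ctd : 1 / (144 * 144 * 128) * tbound tau sigma2 L Delta eps < ts * (d%:R / 2).
  apply: lt_le_trans (_ : ts * (Y / 6) <= _); last by rewrite ler_pM2l//; lra.
  rewrite (_ : ts * (Y / 6) = tbound tau sigma2 L Delta eps * (1 / (144 * 144 * 64))); last first.
    by rewrite /ts /Y; field; rewrite !gt_eqF.
  by rewrite mulrC ltr_pM2l//; lra.
pose f : 'rV[R]_d -> R := schain al la (d := d).
exists d, f, _, bool, (fun _ => bernoulli_prob p : probability bool R), (bern_oracle f p).
split.
  apply: schain_in_F => //; apply: le_trans (ler_wpM2l (ltW al0) tY) _.
  by rewrite /al /Y le_eqVlt; apply/orP; left; apply/eqP; field; rewrite !gt_eqF.
split.
  apply: bern_admissible; first by rewrite p0.
  by rewrite ala /p le_eqVlt; apply/orP; left; apply/eqP; field; rewrite !gt_eqF// mulr_gt0.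
move=> dO O P xi xiP.
have [mslow Pslow] := prob_many_fast (vA d) (zA d) (@prog_bern_oracle d al la p) (ltW ts0)
  tsP p01 pN d0 xiP.
have c0 : 0 <= 4 * eps by rewrite mulr_ge0// ltW.
pose out w := outcome (A d) (bern_oracle f p) tau (coins xi w) f
  (1 / (144 * 144 * 128) * tbound tau sigma2 L Delta eps).
have out0 w : (0 <= out w)%E.
  by apply: le_ereal_inf_tmp => _ [k _ <-]; rewrite lee_fin sqr_ge0.
have outB w : (~` \bigcup_k [set w | d%:R / 2 <=
    (nfast (A d) (bern_oracle f p) tau N (coins xi w) k)%:R :> R]) w ->
    ((4 * eps)%:E <= out w)%E.
  move=> slow; apply: le_ereal_inf_tmp => _ [k /= kt <-]; rewrite lee_fin.
  have xd : (prog (proto_x (A d) (bern_oracle f p) tau (coins xi w) k) < d)%N.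
    apply: (proto_x_prog (vA d) (zA d) (@prog_bern_oracle d al la p) (ltW ts0) tsP d0 ts0 kt ctd).
    by rewrite ltNge; apply/negP => H; apply: slow; exists k.
  have := grad_schain_large al0 la0 xd; rewrite ala; apply: le_trans.
  lra.
(* The value [4 * eps] on an event of probability at least 1/2 leaves [2 * eps]. *)
have H := integral_ge_cst_on P mslow c0 out0 outB.
apply: lt_le_trans H.
have c0' : (0 <= (4 * eps)%:E)%E by rewrite lee_fin.
have H' := lee_wpmul2l c0' Pslow.
apply: lt_le_trans H'.
by rewrite -EFinM lte_fin; lra.
Qed.
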